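(* Let $T\in\mathbb{R}^{n\times n}$ be a banded matrix with $p$ subdiagonals and $q$ superdiagonals ($0\le p,q\le n$). The following are equivalent: (i) $T$ is banded totally positive, i.e. all its nontrivial minors are positive. (ii) All nontrivial submatrices among $\Delta_i[T]$ and $\Delta^i[T]$, $i\in\{1,\dots,n\}$, are nonsingular and totally nonnegative. (iii) All nontrivial initial minors of $T$, i.e. all nontrivial minors with rows $1,2,\dots,r$ and columns $j,j+1,\dots,j+r-1$, and all nontrivial minors with rows $i,i+1,\dots,i+r-1$ and columns $1,2,\dots,r$, are positive. (iv) There is a factorization $T=\hat L_1\cdots\hat L_p\, D\,\hat U_q\cdots\hat U_1$ in which each $\hat L_i=\begin{bmatrix} I_{p-i}&0\\0&L_i\end{bmatrix}$ with $L_i$ a positive bidiagonal lower unitriangular matrix of size $n-p+i$, each $\hat U_i=\begin{bmatrix} I_{q-i}&0\\0&U_i\end{bmatrix}$ with $U_i$ a positive bidiagonal upper unitriangular matrix of size $n-q+i$, and $D$ is a diagonal matrix with positive diagonal entries.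
   Context: Rows and columns are labelled $1,\dots,n$. A matrix $T\in\mathbb{R}^{n\times n}$ belongs to $B_{p,q}$ (banded with $p$ subdiagonals and $q$ superdiagonals) if $T_{i,j}=0$ whenever $j>i+q$ or $i>j+p$. For increasing sequences $i_1<\dots<i_r$ and $j_1<\dots<j_r$ in $\{1,\dots,n\}$, the associated submatrix has entries $(T_{i_k,j_l})_{k,l=1}^r$ and the associated minor is its determinant. For $T\in B_{p,q}$ the submatrix (and its minor) is called trivial (with respect to $(p,q)$) if there is $k\in\{1,\dots,r\}$ such that $j_k>i_k+q$ or $i_k>j_k+p$; otherwise it is nontrivial. A matrix is totally nonnegative if all its minors are $\ge 0$. $\Delta^i[T]$ is the submatrix of $T$ with rows $1,\dots,i$ and columns $n-i+1,\dots,n$; $\Delta_i[T]$ is the submatrix with rows $n-i+1,\dots,n$ and columns $1,\dots,i$. A positive bidiagonal lower (upper) unitriangular matrix is one with ones on the main diagonal, strictly positive entries on the first subdiagonal (first superdiagonal), and zeros elsewhere. $I_m$ is the $m\times m$ identity matrix. *)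

(* Defs.v *)
From HB Require Import structures.
From mathcomp Require Import all_boot all_order all_algebra.
From mathcomp Require Import reals.
Set Implicit Arguments.
Unset Strict Implicit.
Unset Printing Implicit Defensive.
Import Order.TTheory GRing.Theory Num.Theory.
Local Open Scope ring_scope.

(* Rows and columns are 0-based: label i in 1..n is the ordinal i - 1.  Band and
   triviality conditions are invariant under this shift. *)

Definition banded (R : realType) (n p q : nat) (T : 'M[R]_n) : Prop :=
  forall i j : 'I_n, ((i + q < j) || (j + p < i))%N -> T i j = 0.

Definition increasing (r n : nat) (f : 'I_r -> 'I_n) : Prop :=
  {homo f : k l / (k < l)%N}.

Definition trivial_sub (p q r n : nat) (f g : 'I_r -> 'I_n) : Prop :=
  exists k : 'I_r, (f k + q < g k)%N \/ (g k + p < f k)%N.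

Definition nontrivial_sub (p q r n : nat) (f g : 'I_r -> 'I_n) : Prop :=
  ~ trivial_sub p q f g.

(* The case r = 0 only adds the empty minor, which equals 1; the same holds in
   the other quantifications over minors below. *)
Definition totally_nonnegative (R : realType) (m : nat) (A : 'M[R]_m) : Prop :=
  forall (r : nat) (f g : 'I_r -> 'I_m),
    increasing f -> increasing g -> 0 <= \det (mxsub f g A).

Definition banded_totally_positive (R : realType) (n p q : nat)
    (T : 'M[R]_n) : Prop :=
  forall (r : nat) (f g : 'I_r -> 'I_n),
    increasing f -> increasing g -> nontrivial_sub p q f g ->
    0 < \det (mxsub f g T).

Lemma window_subproof (n r s : nat) (h : (s + r <= n)%N) (k : 'I_r) :
  (s + k < n)%N.
Proof. by apply: leq_trans h; rewrite ltn_add2l. Qed.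

(* The r consecutive indices s, s + 1, ..., s + r - 1. *)
Definition window (n r s : nat) (h : (s + r <= n)%N) (k : 'I_r) : 'I_n :=
  Ordinal (window_subproof h k).

Lemma last_subproof (n i : nat) (h : (i <= n)%N) : (n - i + i <= n)%N.
Proof. by rewrite subnK. Qed.

Definition first_idx (n i : nat) (h : (i <= n)%N) : 'I_i -> 'I_n :=
  window (s := 0) h.

Definition last_idx (n i : nat) (h : (i <= n)%N) : 'I_i -> 'I_n :=
  window (last_subproof h).

(* Delta^i[T]: rows 1..i, columns n-i+1..n (1-based). *)
Definition Delta_up (R : realType) (n i : nat) (h : (i <= n)%N)
    (T : 'M[R]_n) : 'M[R]_i := mxsub (first_idx h) (last_idx h) T.

(* Delta_i[T]: rows n-i+1..n, columns 1..i (1-based). *)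
Definition Delta_down (R : realType) (n i : nat) (h : (i <= n)%N)
    (T : 'M[R]_n) : 'M[R]_i := mxsub (last_idx h) (first_idx h) T.

Definition corners_nonsingular_TN (R : realType) (n p q : nat)
    (T : 'M[R]_n) : Prop :=
  forall (i : nat) (h : (i <= n)%N), (0 < i)%N ->
    (nontrivial_sub p q (first_idx h) (last_idx h) ->
       Delta_up h T \in unitmx /\ totally_nonnegative (Delta_up h T)) /\
    (nontrivial_sub p q (last_idx h) (first_idx h) ->
       Delta_down h T \in unitmx /\ totally_nonnegative (Delta_down h T)).

Definition initial_minors_positive (R : realType) (n p q : nat)
    (T : 'M[R]_n) : Prop :=
  forall (r s : nat) (h0 : (r <= n)%N) (h : (s + r <= n)%N),
    (nontrivial_sub p q (first_idx h0) (window h) ->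
       0 < \det (mxsub (first_idx h0) (window h) T)) /\
    (nontrivial_sub p q (window h) (first_idx h0) ->
       0 < \det (mxsub (window h) (first_idx h0) T)).

Definition pos_bidiag_lower (R : realType) (m : nat) (A : 'M[R]_m) : Prop :=
  [/\ forall i : 'I_m, A i i = 1,
      forall i j : 'I_m, i = j.+1 :> nat -> 0 < A i j
    & forall i j : 'I_m, i != j -> i != j.+1 :> nat -> A i j = 0].

Definition pos_bidiag_upper (R : realType) (m : nat) (A : 'M[R]_m) : Prop :=
  [/\ forall i : 'I_m, A i i = 1,
      forall i j : 'I_m, j = i.+1 :> nat -> 0 < A i j
    & forall i j : 'I_m, i != j -> j != i.+1 :> nat -> A i j = 0].

(* M = diag(I_m, A) for some A of size k satisfying P; the equation e only
   serves to view a matrix of size m + k as one of size n. *)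
Definition padded (R : realType) (n m k : nat) (P : 'M[R]_k -> Prop)
    (M : 'M[R]_n) : Prop :=
  exists (e : (m + k)%N = n) (A : 'M[R]_k),
    P A /\ M = castmx (e, e) (block_mx 1%:M 0 0 A).

Definition bidiagonal_factorization (R : realType) (n p q : nat)
    (T : 'M[R]_n) : Prop :=
  exists (Lh Uh : nat -> 'M[R]_n) (d : 'rV[R]_n),
    [/\ forall i, (1 <= i <= p)%N ->
          padded (p - i) (@pos_bidiag_lower R (n - p + i)) (Lh i),
        forall i, (1 <= i <= q)%N ->
          padded (q - i) (@pos_bidiag_upper R (n - q + i)) (Uh i),
        forall k, 0 < d 0 k
      & T = (\big[mulmx/1%:M]_(i <- index_iota 1 p.+1) Lh i) *m diag_mx d
              *m (\big[mulmx/1%:M]_(i <- rev (index_iota 1 q.+1)) Uh i)].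

(* Main.v *)
(* Everything runs through minors of products (Cauchy-Binet). A minor of a
   bidiagonal matrix either vanishes or is a single product of entries, so a
   product of positive bidiagonal factors is totally nonnegative, and a
   nontrivial minor of T is positive because one term of its Cauchy-Binet
   expansion is: the one where the k-th row index descends to min (i_k, j_k)
   through the lower factors and climbs to j_k through the upper ones.
   Conversely, trivial minors contain a zero block too large for the determinant
   to survive, which makes the corner submatrices totally nonnegative; Schur
   complementation shows that the leading minors of a nonsingular totally
   nonnegative matrix are positive, and these are the initial minors of T.
   Positive initial minors give T = L D U with L and U^T again having positive
   initial minors, and L loses one bidiagonal factor, one row and one
   subdiagonal at a time. *)
Require Import Defs.
From HB Require Import structures.
From mathcomp Require Import all_boot all_order all_algebra all_fingroup.
From mathcomp Require Import reals boolp zify.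
Set Implicit Arguments.
Unset Strict Implicit.
Unset Printing Implicit Defensive.
Import Order.TTheory GRing.Theory Num.Theory.
Local Open Scope ring_scope.

(** * Minors with a large zero block *)

(** Every term of the Leibniz expansion meets the block: by counting, no permutation maps the
    [k + 1] indices up to [k] into the [k] indices below [k]. *)
Lemma det_zero_block (R : comNzRingType) (r : nat) (M : 'M[R]_r) (k : 'I_r) :
  (forall i j : 'I_r, (i <= k)%N -> (k <= j)%N -> M i j = 0) -> \det M = 0.
Proof.
move=> M0; apply: big1 => s _.
have [i ik si] : exists2 i : 'I_r, (i <= k)%N & (k <= s i)%N.
  apply/exists_inP; apply: contraT; rewrite negb_exists_in => /forall_inP small.
  pose A := [set i : 'I_r | (i < k)%N].
  have sub : s @: (k |: A) \subset A.
    apply/subsetP => _ /imsetP[i iA ->]; rewrite inE ltnNge small //.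
    by move: iA; rewrite !inE => /orP[/eqP-> //|/ltnW].
  have := subset_leq_card sub; rewrite card_imset; last exact: perm_inj.
  by rewrite cardsU1 inE ltnn /= add1n ltnn.
by rewrite (bigD1 i) //= M0 // mul0r mulr0.
Qed.

Lemma increasing_leq (r n : nat) (f : 'I_r -> 'I_n) (k l : 'I_r) :
  increasing f -> (k <= l)%N -> (f k <= f l)%N.
Proof.
move=> fi; rewrite leq_eqVlt => /orP[/eqP/val_inj-> //|].
by move/(fi k l)/ltnW.
Qed.

Lemma increasing_comp (r m n : nat) (f : 'I_m -> 'I_n) (g : 'I_r -> 'I_m) :
  increasing f -> increasing g -> increasing (f \o g).
Proof. by move=> fi gi k l kl; apply: (fi (g k)); apply: gi. Qed.

Lemma window_increasing (n r s : nat) (h : (s + r <= n)%N) :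
  increasing (window h).
Proof. by move=> k l kl; rewrite /= ltn_add2l. Qed.

(** A band violation at [k] persists for earlier rows and later columns, or the other way round.
    This is the block of [det_zero_block], up to transposition. *)
Lemma det_trivial_sub (R : realType) (n p q r : nat) (T : 'M[R]_n)
    (f g : 'I_r -> 'I_n) :
  banded p q T -> increasing f -> increasing g -> trivial_sub p q f g ->
  \det (mxsub f g T) = 0.
Proof.
move=> bT fi gi [k fgk].
case: fgk => fgk; last rewrite -det_tr;
  apply: (det_zero_block (k := k)) => i j ik kj; rewrite !mxE; apply: bT.
- have := increasing_leq fi ik; have := increasing_leq gi kj; lia.
- have := increasing_leq gi ik; have := increasing_leq fi kj; lia.
Qed.

(** * The Cauchy-Binet formula *)

Section CauchyBinet.

Variables (R : realType) (r n : nat).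

Lemma det_mulmx_expand (A : 'M[R]_(r, n)) (B : 'M[R]_(n, r)) :
  \det (A *m B) =
  \sum_(f : {ffun 'I_r -> 'I_n}) (\prod_i A i (f i)) * \det (rowsub f B).
Proof.
under eq_bigr => f _ do rewrite /determinant big_distrr /=.
rewrite exchange_big /=; apply: eq_bigr => s _.
under eq_bigr => i _ do rewrite mxE.
rewrite bigA_distr_bigA big_distrr /=; apply: eq_bigr => f _.
rewrite mulrCA -big_split /=; congr (_ * _).
by apply: eq_bigr => i _; rewrite !mxE.
Qed.

Lemma det_rowsub_perm (s : 'S_r) (f : 'I_r -> 'I_n) (B : 'M[R]_(n, r)) :
  \det (rowsub (f \o s) B) = (-1) ^+ s * \det (rowsub f B).
Proof.
rewrite -det_perm -det_mulmx -row_permE; congr (\det _).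
by apply/matrixP=> i j; rewrite !mxE.
Qed.

Lemma det_colsub_perm (s : 'S_r) (f : 'I_r -> 'I_n) (A : 'M[R]_(r, n)) :
  \det (colsub (f \o s) A) = (-1) ^+ s * \det (colsub f A).
Proof.
rewrite -[in LHS]det_tr -[in RHS]det_tr !trmx_mxsub; exact: det_rowsub_perm.
Qed.

(* Summing over all index maps rather than over increasing ones counts each
   term of the Cauchy-Binet formula r! times. *)
Lemma Cauchy_Binet (A : 'M[R]_(r, n)) (B : 'M[R]_(n, r)) :
  (r`!)%:R * \det (A *m B) =
  \sum_(f : {ffun 'I_r -> 'I_n}) \det (colsub f A) * \det (rowsub f B).
Proof.
rewrite mulr_natl -card_Sn -sumr_const.
under [RHS]eq_bigr => f _ do rewrite big_distrl /=.
rewrite [RHS]exchange_big det_mulmx_expand /=.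
apply: eq_bigr => s _.
pose h (t : 'S_r) (f : {ffun 'I_r -> 'I_n}) := [ffun i => f (t i)].
(* Replacing [f] by [f \o s] turns the expansion of the determinant into the summand of [s]; the
   sign of [s] comes from permuting the rows of [B]. *)
rewrite (reindex (h s)) /=; last first.
  exists (h s^-1%g) => f _; apply/ffunP => i; rewrite !ffunE ?permK //.
  by rewrite permKV.
apply: eq_bigr => f _.
have -> : rowsub (h s f) B = rowsub (f \o s) B.
  by apply/matrixP => i j; rewrite !mxE ffunE.
rewrite det_rowsub_perm mulrCA mulrA; congr (_ * _ * _).
by apply: eq_bigr => i _; rewrite !mxE ffunE.
Qed.

Lemma det_rowsub_ninj (f : {ffun 'I_r -> 'I_n}) (B : 'M[R]_(n, r)) :
  ~~ injectiveb f -> \det (rowsub f B) = 0.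
Proof.
case/injectivePn => i [j ij fij].
by apply: (determinant_alternate ij) => k; rewrite !mxE fij.
Qed.

(** Sending an index to the number of indices with a smaller value is a permutation; its inverse
    sorts [f]. *)
Lemma injective_sort (f : 'I_r -> 'I_n) :
  injective f -> exists s : 'S_r, increasing (f \o s).
Proof.
move=> fI; pose below i := [set j | (f j < f i)%N].
have rank_lt i : (#|below i| < r)%N.
  rewrite -[X in (_ < X)%N]card_ord -cardsT; apply: proper_card.
  by apply/properP; split; [exact: subsetT | exists i; rewrite !inE ?ltnn].
pose rank i := Ordinal (rank_lt i).
have rank_mono i j : (f i < f j)%N -> (rank i < rank j)%N.
  move=> fij; apply: proper_card; apply/properP; split.
    by apply/subsetP => k; rewrite !inE => /ltn_trans; apply.
  by exists i; rewrite inE // ltnn.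
have rank_inj : injective rank.
  move=> i j ij; apply: fI; apply: val_inj; apply/eqP.
  by case: ltngtP => // /rank_mono; rewrite ij ltnn.
exists ((perm rank_inj)^-1)%g => k l kl.
set s := (_^-1)%g; rewrite /= ltnNge leq_eqVlt; apply/negP => /orP[/eqP E|].
  by move: kl; rewrite (perm_inj (fI _ _ (val_inj E))) ltnn.
by move/rank_mono; rewrite -![rank _](permE rank_inj) !permKV ltnNge (ltnW kl).
Qed.

End CauchyBinet.

(** * Total nonnegativity of products *)

Section MinorsOfProducts.

Variables (R : realType) (n : nat).

(** A noninjective [h] gives zero, and sorting an injective one multiplies both minors by the same
    sign. *)
Lemma Cauchy_Binet_term_ge0 (r : nat) (A B : 'M[R]_n) (f g : 'I_r -> 'I_n)
    (h : {ffun 'I_r -> 'I_n}) :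
  totally_nonnegative A -> totally_nonnegative B ->
  increasing f -> increasing g ->
  0 <= \det (colsub h (rowsub f A)) * \det (rowsub h (colsub g B)).
Proof.
move=> A0 B0 fi gi.
have [/injectiveP hI|hN] := boolP (injectiveb h); last first.
  by rewrite (det_rowsub_ninj _ hN) mulr0.
have [s hs] := injective_sort hI.
suff -> : \det (colsub h (rowsub f A)) * \det (rowsub h (colsub g B)) =
    \det (colsub (h \o s) (rowsub f A)) * \det (rowsub (h \o s) (colsub g B)).
  by rewrite -!mxsub_comp; apply: mulr_ge0; [apply: A0 | apply: B0].
by rewrite det_rowsub_perm det_colsub_perm mulrACA -signr_addb addbb mul1r.
Qed.

Lemma TN_mulmx (A B : 'M[R]_n) :
  totally_nonnegative A -> totally_nonnegative B ->
  totally_nonnegative (A *m B).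
Proof.
move=> A0 B0 r f g fi gi; have r0 : 0 < (r`!)%:R :> R by rewrite ltr0n fact_gt0.
rewrite -(pmulr_rge0 _ r0) mxsub_mul Cauchy_Binet; apply: sumr_ge0 => h _.
exact: Cauchy_Binet_term_ge0.
Qed.

(** No Cauchy-Binet term is negative, so a single positive one, at the intermediate indices [h],
    suffices. *)
Lemma minor_mulmx_gt0 (r : nat) (A B : 'M[R]_n) (f g h : 'I_r -> 'I_n) :
  totally_nonnegative A -> totally_nonnegative B ->
  increasing f -> increasing g ->
  0 < \det (mxsub f h A) -> 0 < \det (mxsub h g B) ->
  0 < \det (mxsub f g (A *m B)).
Proof.
move=> A0 B0 fi gi Ah Bh.
have r0 : 0 < (r`!)%:R :> R by rewrite ltr0n fact_gt0.
rewrite -(pmulr_rgt0 _ r0) mxsub_mul Cauchy_Binet (bigD1 (finfun h)) //=.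
apply: ltr_wpDr.
  by apply: sumr_ge0 => k _; apply: Cauchy_Binet_term_ge0.
have -> : colsub (finfun h) (rowsub f A) = mxsub f h A.
  by apply/matrixP=> i j; rewrite !mxE ffunE.
have -> : rowsub (finfun h) (colsub g B) = mxsub h g B.
  by apply/matrixP=> i j; rewrite !mxE ffunE.
exact: mulr_gt0.
Qed.

Lemma TN_tr (A : 'M[R]_n) : totally_nonnegative A -> totally_nonnegative A^T.
Proof. by move=> A0 r f g fi gi; rewrite -trmx_mxsub det_tr; apply: A0. Qed.

End MinorsOfProducts.

(** * Bidiagonal matrices and their products *)

HB.instance Definition _ (R : realType) (n : nat) :=
  Monoid.isLaw.Build 'M[R]_n 1%:M mulmx
    (@mulmxA R n n n n) (@mul1mx R n n) (@mulmx1 R n n).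

(* The entries of diag(I_m, L) with L positive bidiagonal lower unitriangular. *)
Definition lower_bidiag (R : realType) (n m : nat) (M : 'M[R]_n) : Prop :=
  [/\ forall i : 'I_n, M i i = 1,
      forall i j : 'I_n, i = j.+1 :> nat -> (m <= j)%N -> 0 < M i j
    & forall i j : 'I_n, i != j -> (i != j.+1 :> nat) || (j < m)%N -> M i j = 0].

(** Trades blocks and casts for conditions on entries, which reduce to index arithmetic. *)
Lemma padded_lowerP (R : realType) (n m k : nat) (M : 'M[R]_n) :
  (m + k)%N = n ->
  padded m (@pos_bidiag_lower R k) M <-> lower_bidiag m M.
Proof.
move=> e; split.
- case=> e' [A [[A1 A2 A3] ->]]; subst n; rewrite castmx_id; split.
  + move=> i; case: (split_ordP i) => a ->; rewrite ?block_mxEul ?block_mxEdr //.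
    by rewrite mxE eqxx.
  + move=> i j; case: (split_ordP i) => a ->; case: (split_ordP j) => b -> /=.
    * by have := ltn_ord b; lia.
    * by have := ltn_ord a; lia.
    * by have := ltn_ord b; lia.
    * by rewrite block_mxEdr => ab _; apply: A2; lia.
  + move=> i j; case: (split_ordP i) => a ->; case: (split_ordP j) => b ->;
      rewrite ?block_mxEul ?block_mxEdr ?block_mxEur ?block_mxEdl ?mxE //.
      by rewrite (inj_eq (@lshift_inj _ _)) => /negPf->.
    rewrite (inj_eq (@rshift_inj _ _)) /= => ab h; apply: A3 => //; lia.
- move=> [M1 M2 M3]; exists e; subst n.
  exists (drsubmx M); split.
    split=> [i|i j ij|i j ij ij'].
    + by rewrite !mxE M1.
    + by rewrite !mxE; apply: M2 => /=; lia.
    + by rewrite !mxE; apply: M3; rewrite ?(inj_eq (@rshift_inj _ _)) //=; lia.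
  rewrite castmx_id -[LHS]submxK; congr block_mx; apply/matrixP => i j.
  + rewrite !mxE; have [->|ij] := eqVneq i j; first by rewrite M1.
    by apply: M3; rewrite ?(inj_eq (@lshift_inj _ _)) //= ltn_ord orbT.
  + rewrite !mxE; have := ltn_ord i => im; apply: M3; rewrite -?val_eqE /=; lia.
  + rewrite !mxE; have := ltn_ord j => jm; apply: M3; rewrite -?val_eqE /=; lia.
Qed.

Lemma pos_bidiag_tr (R : realType) (k : nat) (A : 'M[R]_k) :
  pos_bidiag_upper A <-> pos_bidiag_lower A^T.
Proof.
split=> -[A1 A2 A3]; split=> [i|i j ij|i j ij ij'].
- by rewrite mxE.
- by rewrite mxE; apply: A2.
- by rewrite mxE; apply: A3 => //; rewrite eq_sym.
- by rewrite -(A1 i) mxE.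
- by have := A2 j i ij; rewrite mxE.
- by have := A3 j i; rewrite mxE => -> //; rewrite eq_sym.
Qed.

Lemma padded_upperP (R : realType) (n m k : nat) (M : 'M[R]_n) :
  (m + k)%N = n ->
  padded m (@pos_bidiag_upper R k) M <-> lower_bidiag m M^T.
Proof.
move=> e; rewrite -(padded_lowerP _ e); split=> -[e' [A [PA MA]]].
- exists e', A^T; split; first by apply/pos_bidiag_tr.
  by rewrite MA trmx_cast tr_block_mx !trmx0 trmx1.
- exists e', A^T; split; first by apply/pos_bidiag_tr; rewrite trmxK.
  by rewrite -[M]trmxK MA trmx_cast tr_block_mx !trmx0 trmx1.
Qed.

(* When f 0 = g 0 the first row of the minor has a single nonzero entry, and
   when f 0 = g 0 + 1 the first column does. *)
Lemma det_bidiag_minor (R : realType) (n : nat) (M : 'M[R]_n) :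
  (forall i j : 'I_n, i != j -> i != j.+1 :> nat -> M i j = 0) ->
  forall (r : nat) (f g : 'I_r -> 'I_n), increasing f -> increasing g ->
  (forall t, (g t <= f t <= (g t).+1)%N) ->
  \det (mxsub f g M) = \prod_t M (f t) (g t).
Proof.
move=> M0; elim=> [|r IHr] f g fi gi fg; first by rewrite det_mx00 big_ord0.
have liftE : mxsub (f \o lift ord0) (g \o lift ord0) M =
    row' ord0 (col' ord0 (mxsub f g M)) by apply/matrixP=> i j; rewrite !mxE.
have lift_incr (h : 'I_r.+1 -> 'I_n) : increasing h -> increasing (h \o lift ord0).
  by move=> hi; apply: increasing_comp.
have IH : cofactor (mxsub f g M) ord0 ord0 =
    \prod_(t < r) M (f (lift ord0 t)) (g (lift ord0 t)).
  rewrite /cofactor addn0 expr0 mul1r -liftE IHr //; try exact: lift_incr.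
  by move=> t; apply: fg.
have [fg0|fg0] := eqVneq (f ord0) (g ord0).
- rewrite (expand_det_row _ ord0) !big_ord_recl /= big1 ?addr0 => [|t _].
    by rewrite mxE IH.
  rewrite !mxE M0 ?mul0r // fg0 -?val_eqE;
    have /= := gi ord0 (lift ord0 t) isT; lia.
- rewrite (expand_det_col _ ord0) !big_ord_recl /= big1 ?addr0 => [|t _].
    by rewrite mxE IH.
  rewrite !mxE M0 ?mul0r // -?val_eqE; have /= := fi ord0 (lift ord0 t) isT;
    have := fg ord0; move: fg0; rewrite -val_eqE /=; lia.
Qed.

Lemma lower_bidiag_ge0 (R : realType) (n m : nat) (M : 'M[R]_n) i j :
  lower_bidiag m M -> 0 <= M i j.
Proof.
move=> [M1 M2 M3]; have [->|ij] := eqVneq i j; first by rewrite M1.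
case: (boolP ((i != j.+1 :> nat) || (j < m)%N)) => [h|]; first by rewrite M3.
by rewrite negb_or negbK -leqNgt => /andP[/eqP h ?]; apply/ltW/M2.
Qed.

Lemma lower_bidiag_band (R : realType) (n m : nat) (M : 'M[R]_n) :
  lower_bidiag m M -> banded 1 0 M.
Proof.
by move=> [_ _ M3] i j h; apply: M3; rewrite -?val_eqE /=; lia.
Qed.

(** With one subdiagonal and no superdiagonal, a trivial minor vanishes and a nontrivial one is a
    product of entries. *)
Lemma lower_bidiag_TN (R : realType) (n m : nat) (M : 'M[R]_n) :
  lower_bidiag m M -> totally_nonnegative M.
Proof.
move=> Mb r f g fi gi; have [tr|ntr] := pselect (trivial_sub 1 0 f g).
  by rewrite (det_trivial_sub (lower_bidiag_band Mb)).
rewrite det_bidiag_minor //.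
- by apply: prodr_ge0 => t _; apply: lower_bidiag_ge0 Mb.
- by case: Mb => _ _ M3 i j ij ij'; apply: M3 => //; rewrite ij'.
- move=> t; apply/negP => /negP h; apply: ntr; exists t; lia.
Qed.

Lemma lower_bidiag_minor_gt0 (R : realType) (n m : nat) (M : 'M[R]_n) :
  lower_bidiag m M ->
  forall (r : nat) (f g : 'I_r -> 'I_n), increasing f -> increasing g ->
  (forall t, (g t <= f t <= (g t).+1)%N /\ ((g t < f t)%N -> (m <= g t)%N)) ->
  0 < \det (mxsub f g M).
Proof.
move=> [M1 M2 M3] r f g fi gi fg; rewrite det_bidiag_minor //.
- apply: prodr_gt0 => t _; case: (fg t) => b mg.
  have [->|/negP ne] := eqVneq (f t) (g t); first by rewrite M1.
  by apply: M2; [|apply: mg]; move: ne; rewrite -val_eqE /=; lia.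
- by move=> i j ij ij'; apply: M3 => //; rewrite ij'.
- by move=> t; case: (fg t).
Qed.

Lemma TN1 (R : realType) (n : nat) : totally_nonnegative (1%:M : 'M[R]_n).
Proof.
(* Padding by [n] leaves no subdiagonal entry, so the identity is a degenerate case. *)
apply: (lower_bidiag_TN (m := n)); split=> [i|i j|i j ij _].
- by rewrite mxE eqxx.
- by have := ltn_ord j; lia.
- by rewrite mxE (negPf ij).
Qed.

(* A path descending from row f t to column g t takes its unit steps in the
   last f t - g t factors, which are the ones with the least padding. *)
Lemma lower_prod_minors (R : realType) (n p : nat) (L : nat -> 'M[R]_n) :
  (forall i, (1 <= i <= p)%N -> lower_bidiag (p - i) (L i)) ->
  forall k, (k <= p)%N ->
  let P := \big[mulmx/1%:M]_(i <- index_iota 1 k.+1) L i in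
  totally_nonnegative P /\
  forall (r : nat) (f g : 'I_r -> 'I_n), increasing f -> increasing g ->
  (forall t, (g t <= f t <= g t + k)%N /\ ((g t < f t)%N -> (p - k <= g t)%N)) ->
  0 < \det (mxsub f g P).
Proof.
move=> Lb; elim=> [|k IHk] kp /=.
  rewrite big_nil; split=> [|r f g fi gi fg]; first exact: TN1.
  have -> : mxsub f g (1%:M : 'M[R]_n) = 1%:M; last by rewrite det1.
  have E : f =1 g by move=> t; apply: val_inj => /=; have [] := fg t; lia.
  apply/matrixP=> i j; rewrite !mxE E; congr (nat_of_bool _)%:R.
  apply/eqP/eqP => [gij|-> //]; apply: val_inj; apply/eqP.
  by case: ltngtP => // /gi; rewrite gij ltnn.
have [PTN Ppos] := IHk (ltnW kp).
rewrite big_nat_recr //=.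
set P := \big[_/_]_(_ <= i < _) _ in PTN Ppos *.
have Lk : lower_bidiag (p - k.+1) (L k.+1) by apply: Lb; lia.
split=> [|r f g fi gi fg]; first exact/TN_mulmx/lower_bidiag_TN/Lk.
(* The last factor takes at most one step: the earlier ones lead from [f t] to [g t + 1], or stay at
   [f t] when [f t = g t]. *)
have h_lt (t : 'I_r) : (minn (f t) (g t).+1 < n)%N.
  by have := ltn_ord (f t); lia.
pose h t : 'I_n := Ordinal (h_lt t).
have hi : increasing h.
  by move=> s t st; rewrite /=; have := fi s t st; have := gi s t st; lia.
apply: (minor_mulmx_gt0 (h := h)) => //.
- exact: lower_bidiag_TN Lk.
- by apply: Ppos => // t; case: (fg t) => /=; lia.
- apply: (lower_bidiag_minor_gt0 Lk) => // t; case: (fg t) => /=; lia.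
Qed.

(** Pulling the positive row factors out of a minor leaves a minor of the identity. *)
Lemma TN_diag_mx (R : realType) (n : nat) (d : 'rV[R]_n) :
  (forall k, 0 < d 0 k) -> totally_nonnegative (diag_mx d).
Proof.
move=> d0 r f g fi gi.
rewrite -[diag_mx d]mulmx1 mul_diag_mx.
have -> : mxsub f g (\matrix_(i, j) (d 0 i * (1%:M : 'M[R]_n) i j)) =
    diag_mx (\row_k d 0 (f k)) *m mxsub f g 1%:M.
  by apply/matrixP => i j; rewrite mul_diag_mx !mxE.
rewrite det_mulmx det_diag; apply: mulr_ge0; last exact: TN1.
by apply: prodr_ge0 => k _; rewrite mxE ltW.
Qed.

Lemma trmx_prod_rev (R : realType) (n : nat) (s : seq nat) (F : nat -> 'M[R]_n) :
  (\big[mulmx/1%:M]_(i <- rev s) F i)^T = \big[mulmx/1%:M]_(i <- s) (F i)^T.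
Proof.
elim: s => [|i s IHs]; first by rewrite !big_nil trmx1.
by rewrite rev_cons big_rcons /= trmx_mul IHs big_cons.
Qed.

Lemma factorization_BTP (R : realType) (n p q : nat) (T : 'M[R]_n) :
  (p <= n)%N -> (q <= n)%N ->
  bidiagonal_factorization p q T -> banded_totally_positive p q T.
Proof.
move=> hp hq [Lh [Uh [d [HL HU d0 ->]]]] r f g fi gi ntr.
have LB i : (1 <= i <= p)%N -> lower_bidiag (p - i) (Lh i).
  move=> ip; have e : (p - i + (n - p + i))%N = n by lia.
  by apply/(padded_lowerP _ e)/HL.
have UB i : (1 <= i <= q)%N -> lower_bidiag (q - i) (Uh i)^T.
  move=> iq; have e : (q - i + (n - q + i))%N = n by lia.
  by apply/(padded_upperP _ e)/HU.
have [LTN Lpos] := lower_prod_minors LB (leqnn p).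
have [UTN Upos] := lower_prod_minors UB (leqnn q).
set L := \big[mulmx/1%:M]_(i <- index_iota 1 p.+1) Lh i in LTN Lpos *.
set U := \big[mulmx/1%:M]_(i <- rev _) Uh i.
(* Transposition reverses the product, so [U^T] is a product of lower factors in increasing
   order. *)
rewrite -trmx_prod_rev -/U in UTN Upos.
have {}UTN := TN_tr UTN; rewrite trmxK in UTN.
have DTN := TN_diag_mx d0.
have h_lt (t : 'I_r) : (minn (f t) (g t) < n)%N.
  by have := ltn_ord (f t); lia.
pose h t : 'I_n := Ordinal (h_lt t).
have hi : increasing h.
  by move=> s t st; rewrite /=; have := fi s t st; have := gi s t st; lia.
have near t : (f t <= g t + p)%N && (g t <= f t + q)%N.
  by apply/negP => /negP H; apply: ntr; exists t; lia.
apply: (minor_mulmx_gt0 (h := h)) => //.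
- exact: TN_mulmx.
- rewrite mul_mx_diag.
  have -> : mxsub f h (\matrix_(i, j) (L i j * d 0 j)) =
      mxsub f h L *m diag_mx (\row_k d 0 (h k)).
    by apply/matrixP => i j; rewrite mul_mx_diag !mxE.
  rewrite det_mulmx det_diag; apply: mulr_gt0.
    by apply: Lpos => // t; have := near t; rewrite /=; lia.
  by apply: prodr_gt0 => k _; rewrite mxE.
- rewrite -det_tr trmx_mxsub; apply: Upos => // t.
  by have := near t; rewrite /=; lia.
Qed.

(** * Schur complements and leading minors *)

Definition schur (R : realType) (m : nat) (A : 'M[R]_m.+1) : 'M[R]_m :=
  \matrix_(i, j) (A (lift ord0 i) (lift ord0 j)
                  - A (lift ord0 i) ord0 / A ord0 ord0 * A ord0 (lift ord0 j)).

Definition cons_idx (r m : nat) (f : 'I_r -> 'I_m) (i : 'I_r.+1) : 'I_m.+1 :=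
  if unlift ord0 i is Some k then lift ord0 (f k) else ord0.

Lemma cons_idx0 (r m : nat) (f : 'I_r -> 'I_m) : cons_idx f ord0 = ord0.
Proof. by rewrite /cons_idx unlift_none. Qed.

Lemma cons_idxS (r m : nat) (f : 'I_r -> 'I_m) k :
  cons_idx f (lift ord0 k) = lift ord0 (f k).
Proof. by rewrite /cons_idx liftK. Qed.

Lemma cons_idx_increasing (r m : nat) (f : 'I_r -> 'I_m) :
  increasing f -> increasing (cons_idx f).
Proof.
move=> fi k l; case: (unliftP ord0 l) => [l' ->|->]; last by rewrite ltn0.
rewrite cons_idxS; case: (unliftP ord0 k) => [k' ->|->]; last by rewrite cons_idx0.
by rewrite cons_idxS /= => /fi.
Qed.

Lemma cons_idx_first (r m : nat) (h : (r <= m)%N) (h' : (r.+1 <= m.+1)%N) :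
  cons_idx (first_idx h) =1 first_idx h'.
Proof.
move=> k; apply: val_inj; case: (unliftP ord0 k) => [k' ->|->].
  by rewrite cons_idxS.
by rewrite cons_idx0.
Qed.

(** One step of block elimination, with the factorization of the Schur complement left open: [X = 1]
    yields the determinant, a triangular pair yields an LU factorization. *)
Lemma schur_mulmx (R : realType) (m : nat) (A : 'M[R]_m.+1) (X Y : 'M[R]_m) :
  A ord0 ord0 != 0 -> X *m Y = schur A ->
  A = block_mx (1%:M : 'M_1) 0 (\col_i (A (lift ord0 i) ord0 / A ord0 ord0)) X
      *m block_mx (A ord0 ord0)%:M (\row_j A ord0 (lift ord0 j)) 0 Y :> 'M_(1 + m).
Proof.
move=> a0 XY; rewrite mulmx_block !mul1mx !mul0mx !mulmx0 !addr0 XY mul_mx_scalar.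
apply/matrixP => i j.
have lE k : rshift 1 k = lift ord0 k :> 'I_m.+1 by apply: val_inj.
have zE (k : 'I_1) : lshift m k = ord0 :> 'I_m.+1.
  by rewrite ord1; apply: val_inj.
case: (@split_ordP 1 m i) => a ->; case: (@split_ordP 1 m j) => b ->.
- by rewrite block_mxEul !mxE !zE !ord1 eqxx.
- by rewrite block_mxEur !mxE lE zE.
- by rewrite block_mxEdl !mxE lE zE mulrC divfK.
- by rewrite block_mxEdr !mxE big_ord1 !mxE !lE addrC subrK.
Qed.

Lemma det_schur (R : realType) (m : nat) (A : 'M[R]_m.+1) :
  A ord0 ord0 != 0 -> \det A = A ord0 ord0 * \det (schur A).
Proof.
move=> a0.
have := congr1 (@determinant R (1 + m)) (schur_mulmx a0 (mul1mx (schur A))).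
by rewrite det_mulmx det_lblock det_ublock !det1 !mul1r det_scalar1.
Qed.

(** Schur complementation commutes with restriction to rows and columns that include the first. *)
Lemma det_schur_sub (R : realType) (m r : nat) (A : 'M[R]_m.+1)
    (f g : 'I_r -> 'I_m) :
  A ord0 ord0 != 0 ->
  \det (mxsub (cons_idx f) (cons_idx g) A) =
  A ord0 ord0 * \det (mxsub f g (schur A)).
Proof.
move=> a0; rewrite det_schur mxE !cons_idx0 //; congr (_ * \det _).
by apply/matrixP=> i j; rewrite !mxE !cons_idxS !cons_idx0.
Qed.

Lemma det_schur_leading (R : realType) (m r : nat) (A : 'M[R]_m.+1)
    (h : (r <= m)%N) (h' : (r.+1 <= m.+1)%N) :
  A ord0 ord0 != 0 ->
  \det (mxsub (first_idx h') (first_idx h') A) =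
  A ord0 ord0 * \det (mxsub (first_idx h) (first_idx h) (schur A)).
Proof.
move=> a0; rewrite -det_schur_sub //; congr (\det _).
by apply: eq_mxsub => k; rewrite cons_idx_first.
Qed.

Lemma TN_entry_ge0 (R : realType) (m : nat) (A : 'M[R]_m) i j :
  totally_nonnegative A -> 0 <= A i j.
Proof.
move=> A0; have := A0 1%N (fun=> i) (fun=> j).
by rewrite det_mx11 mxE; apply; move=> k l; rewrite !ord1 ltnn.
Qed.

(** If the entry vanished, nonsingularity would give nonzero entries elsewhere in the first row and
    column, and the 2 by 2 minor through them would be minus their product, hence negative. *)
Lemma TN_unit_entry00_gt0 (R : realType) (m : nat) (A : 'M[R]_m.+1) :
  totally_nonnegative A -> A \in unitmx -> 0 < A ord0 ord0.
Proof.
move=> A0; rewrite unitmxE unitfE; apply: contraNT.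
rewrite lt0r (TN_entry_ge0 _ _ A0) andbT negbK => /eqP a0.
have [/existsP[i Ai]|/existsPn Ai0] := boolP [exists i, A i ord0 != 0]; last first.
  rewrite (expand_det_col _ ord0) big1 // => i _.
  by have := Ai0 i; rewrite negbK => /eqP->; rewrite mul0r.
have [/existsP[j Aj]|/existsPn Aj0] := boolP [exists j, A ord0 j != 0]; last first.
  rewrite (expand_det_row _ ord0) big1 // => j _.
  by have := Aj0 j; rewrite negbK => /eqP->; rewrite mul0r.
have incr2 (k : 'I_m.+1) : A k ord0 != 0 \/ A ord0 k != 0 ->
    increasing (fun t : 'I_2 => if t == ord0 then ord0 else k).
  have [->|k0 _] := eqVneq k ord0; first by rewrite a0 eqxx => -[].
  move=> s t; case: (unliftP ord0 t) => [t' ->|->]; last by rewrite ltn0.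
  case: (unliftP ord0 s) => [s' ->|-> _]; first by rewrite !ord1.
  by rewrite /= lt0n.
have := A0 2 _ _ (incr2 i (or_introl Ai)) (incr2 j (or_intror Aj)).
rewrite (expand_det_row _ ord0) !big_ord_recl big_ord0 addr0 /cofactor.
rewrite !det_mx11 !mxE /= a0 mul0r add0r expr1 mulN1r mulrN oppr_ge0 leNgt.
by rewrite mulr_gt0 // lt0r (TN_entry_ge0 _ _ A0) ?Ai ?Aj.
Qed.

(** Minors of the Schur complement are minors of [A] divided by a positive entry, so total
    nonnegativity and invertibility pass to it; induction on the size applies. *)
Lemma TN_unit_leading_gt0 (R : realType) (m : nat) (A : 'M[R]_m) :
  totally_nonnegative A -> A \in unitmx ->
  forall (r : nat) (h : (r <= m)%N),
    0 < \det (mxsub (first_idx h) (first_idx h) A).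
Proof.
elim: m A => [|m IHm] A A0 Au [|r] h //; rewrite ?det_mx00 ?ltr01 //.
have a0 := TN_unit_entry00_gt0 A0 Au; have an0 := lt0r_neq0 a0.
have hr : (r <= m)%N by [].
rewrite (det_schur_leading hr) // pmulr_rgt0 //; apply: IHm.
  move=> s f g fi gi; rewrite -(pmulr_rge0 _ a0) -det_schur_sub //.
  by apply: A0; apply: cons_idx_increasing.
by move: Au; rewrite !unitmxE det_schur // unitrM => /andP[].
Qed.

(** * LU factorization *)

Definition unit_lower (R : realType) (n : nat) (L : 'M[R]_n) : Prop :=
  (forall i, L i i = 1) /\ (forall i j : 'I_n, (i < j)%N -> L i j = 0).

(** The positive diagonal stays in the upper factor; $D$ is split off only at the end. *)
Definition upper_pos (R : realType) (n : nat) (Y : 'M[R]_n) : Prop :=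
  (forall i, 0 < Y i i) /\ (forall i j : 'I_n, (j < i)%N -> Y i j = 0).

Lemma unit_lower_block (R : realType) (n : nat) (c : 'cV[R]_n) (L : 'M[R]_n) :
  unit_lower L -> unit_lower (block_mx (1%:M : 'M_1) 0 c L).
Proof.
move=> [L1 L0]; split=> i.
- case: (split_ordP i) => k ->; rewrite ?block_mxEul ?block_mxEdr //.
  by rewrite mxE eqxx.
- move=> j; case: (split_ordP i) => k ->; case: (split_ordP j) => l ->.
  + by rewrite !ord1 ltnn.
  + by rewrite block_mxEur mxE.
  + by rewrite [l]ord1.
  + by rewrite block_mxEdr /= => kl; apply: L0; lia.
Qed.

Lemma upper_pos_block (R : realType) (n : nat) (a : R) (u : 'rV[R]_n)
    (Y : 'M[R]_n) :
  0 < a -> upper_pos Y -> upper_pos (block_mx (a%:M : 'M_1) u 0 Y).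
Proof.
move=> a0 [Y1 Y0]; split=> i.
- case: (split_ordP i) => k ->; rewrite ?block_mxEul ?block_mxEdr //.
  by rewrite mxE eqxx.
- move=> j; case: (split_ordP i) => k ->; case: (split_ordP j) => l ->.
  + by rewrite !ord1 ltnn.
  + by rewrite [k]ord1.
  + by rewrite block_mxEdl mxE.
  + by rewrite block_mxEdr /= => kl; apply: Y0; lia.
Qed.

(** Leading minors of the Schur complement are those of [A] divided by its corner entry, so the
    factors grow by induction on the size. *)
Lemma LU_factorization (R : realType) (n : nat) (A : 'M[R]_n) :
  (forall (r : nat) (h : (r <= n)%N),
     0 < \det (mxsub (first_idx h) (first_idx h) A)) ->
  exists L Y : 'M[R]_n, [/\ unit_lower L, upper_pos Y & A = L *m Y].
Proof.
elim: n A => [|n IHn] A lead.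
  by exists 1%:M, 1%:M; split; [split=> -[] | split=> -[] | apply/matrixP=> -[]].
have a0 : 0 < A ord0 ord0.
  have := lead 1%N (ltn0Sn n); rewrite det_mx11 mxE.
  by have -> : first_idx (ltn0Sn n) 0 = ord0 by apply: val_inj.
have [|L1 [Y1 [[L11 L10] [Y11 Y10] E]]] := IHn (schur A).
  move=> r h; have := lead r.+1 h.
  by rewrite (det_schur_leading h) ?lt0r_neq0 // pmulr_rgt0.
have AE := schur_mulmx (lt0r_neq0 a0) (esym E).
eexists; eexists; split; last exact: AE; first exact: unit_lower_block.
exact: upper_pos_block.
Qed.

(** The first [r] columns of [Y] vanish outside its first [r] rows. Hence right multiplication by
    [Y] only scales a minor on the first columns by a leading minor of [Y]. *)
Lemma leading_columns_mulmx (R : realType) (n r : nat) (h : (r <= n)%N)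
    (f : 'I_r -> 'I_n) (X Y : 'M[R]_n) :
  upper_pos Y ->
  mxsub f (first_idx h) (X *m Y) =
  mxsub f (first_idx h) X *m mxsub (first_idx h) (first_idx h) Y.
Proof.
move=> [_ Y0]; have [m en] : exists m, n = (r + m)%N by exists (n - r)%N; lia.
subst n; apply/matrixP => i j; rewrite !mxE big_split_ord /=.
rewrite [X in _ + X]big1 => [|k _]; last first.
  by rewrite Y0 ?mulr0 //=; have := ltn_ord j; lia.
rewrite addr0; apply: eq_bigr => k _; rewrite !mxE.
by have -> : lshift m k = first_idx h k by apply: val_inj.
Qed.

Lemma det_leading_upper (R : realType) (n r : nat) (h : (r <= n)%N)
    (Y : 'M[R]_n) :
  upper_pos Y -> 0 < \det (mxsub (first_idx h) (first_idx h) Y).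
Proof.
move=> [Y1 Y0]; rewrite -det_tr det_trig.
  by apply: prodr_gt0 => k _; rewrite !mxE.
by apply/is_trig_mxP => i j ij; rewrite !mxE; apply: Y0.
Qed.

(** * Peeling off bidiagonal factors *)

(** For [r > 0], the bound [s <= p] says exactly that the minor is nontrivial. *)
Definition lower_initial_pos (R : realType) (n p : nat) (A : 'M[R]_n) : Prop :=
  (forall i j : 'I_n, (j + p < i)%N -> A i j = 0) /\
  forall (r s : nat) (h0 : (r <= n)%N) (h : (s + r <= n)%N), (s <= p)%N ->
    0 < \det (mxsub (window h) (first_idx h0) A).

Lemma lower_initial_pos_upper (R : realType) (n p : nat) (A L Y : 'M[R]_n) :
  A = L *m Y -> upper_pos Y -> lower_initial_pos p A -> lower_initial_pos p L.
Proof.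
move=> AE Yp [Ab Ap]; split; last first.
  move=> r s h0 h sp; have := Ap r s h0 h sp.
  by rewrite AE leading_columns_mulmx // det_mulmx pmulr_lgt0 // det_leading_upper.
(* Strong induction on the column: in the product, terms left of [j] lie even further below the
   band, and those right of [j] vanish since [Y] is upper triangular. Only [L i j * Y j j]
   remains. *)
case: Yp => Y1 Y0 i j; have [k] := ubnP (j : nat); elim: k => // k IHk in j *.
move=> jk ij; have := Ab i j ij; rewrite AE mxE (bigD1 j) //= big1 => [|l lj].
  by rewrite addr0 => /eqP; rewrite mulf_eq0 (gt_eqF (Y1 j)) orbF => /eqP.
case: (ltngtP l j) => [lj'|jl|/val_inj E].
- by rewrite IHk ?mul0r //; lia.
- by rewrite Y0 ?mulr0.
- by rewrite E eqxx in lj.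
Qed.

(** Forward substitution: once the earlier rows of [Z] vanish in column [j], row [i] of the equation
    reads [Z i j = D i j]. *)
Lemma unit_lower_mulmx_left (R : realType) (n : nat) (X Z D : 'M[R]_n) :
  X *m Z = D -> unit_lower X -> unit_lower D -> unit_lower Z.
Proof.
move=> XZ [X1 X0] [D1 D0].
have rowE (i j : 'I_n) : (i <= j)%N ->
    (forall k : 'I_n, (k < i)%N -> Z k j = 0) -> D i j = Z i j.
  move=> ij Zk; rewrite -XZ mxE (bigD1 i) //= X1 mul1r big1 ?addr0 // => k ki.
  case: (ltngtP k i) => [/Zk->|/X0->|/val_inj E]; rewrite ?mulr0 ?mul0r //.
  by rewrite E eqxx in ki.
have Z0 (i j : 'I_n) : (i < j)%N -> Z i j = 0.
  have [k] := ubnP (i : nat); elim: k => // k IHk in i *; move=> ik ij.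
  rewrite -(rowE i j (ltnW ij)); first exact: D0.
  by move=> l li; apply: IHk; lia.
split=> [i|//]; rewrite -(rowE i i (leqnn i)); first exact: D1.
by move=> k; apply: Z0.
Qed.

(* Deleting the first row of L and the last column leaves N = L2 Y; M compares
   L2 with the rest of L: dropping its last column leaves Y, which is upper
   triangular, while dropping its first column leaves a unit lower triangular
   matrix, so M is bidiagonal. *)
Lemma peel_bidiagonal (R : realType) (n p : nat) (L : 'M[R]_(1 + n)) :
  unit_lower L -> lower_initial_pos p.+1 L ->
  exists (L2 : 'M[R]_n) (B : 'M[R]_(1 + n)),
    [/\ unit_lower L2, lower_initial_pos p L2, lower_bidiag 0 B
      & L = block_mx (1%:M : 'M_1) 0 0 L2 *m B].
Proof.
move=> [L1 L0] [Lb Lp].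
pose widen : 'I_n -> 'I_(1 + n) := widen_ord (leqnSn n).
pose N := mxsub (@rshift 1 n) widen L.
(* Row [i] of [N] comes from row [i + 1] of [L], so a window at [s] sits at [s + 1] in [L], and
   [p + 1] drops to [p]. *)
have Np : lower_initial_pos p N.
  split=> [i j ij|r s h0 h sp]; first by rewrite mxE Lb //=; lia.
  have h0' : (r <= 1 + n)%N by lia.
  have h' : (s.+1 + r <= 1 + n)%N by lia.
  have := Lp r s.+1 h0' h' sp; congr (0 < \det _); rewrite -mxsub_comp.
  by apply: eq_mxsub => k; apply: val_inj.
have [L2 [Y [L2u Yp NE]]] : exists L2 Y : 'M[R]_n,
    [/\ unit_lower L2, upper_pos Y & N = L2 *m Y].
  apply: LU_factorization => r h; have := proj2 Np r 0%N h h (leq0n _).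
  by congr (0 < \det _).
have L2inv : L2 \in unitmx.
  rewrite unitmxE det_trig; last by apply/is_trig_mxP; case: L2u.
  by rewrite big1 ?unitr1 // => i _; case: L2u.
have [M LM] : exists M, L2 *m M = dsubmx L.
  by exists (invmx L2 *m dsubmx L); rewrite mulKVmx.
have MY : colsub widen M = Y.
  apply: (can_inj (mulKmx L2inv)); rewrite mulmx_colsub LM -NE.
  by apply/matrixP=> i j; rewrite !mxE.
have [M1 M0] : unit_lower (colsub (@rshift 1 n) M).
  apply: (@unit_lower_mulmx_left _ _ L2 _ (drsubmx L)) => //.
    by rewrite mulmx_colsub LM; apply/matrixP=> i j; rewrite !mxE.
  by split=> [i|i j ij]; rewrite !mxE ?L1 ?L0.
case: Yp => Y1 Y0.
(* The first row of [L] is the first unit vector, so it can serve unchanged as the first row of the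
   bidiagonal factor. *)
exists L2, (col_mx (usubmx L) M); split=> //.
- exact: lower_initial_pos_upper NE (conj Y1 Y0) Np.
- have widenE (j : 'I_(1 + n)) : (j < n)%N -> exists j', j = widen j'.
    by move=> jn; exists (Ordinal jn); apply: val_inj.
  have MYE i j : M i (widen j) = Y i j by rewrite -MY mxE.
  split=> [i|i j|i j].
  + case: (split_ordP i) => k ->; first by rewrite col_mxEu mxE L1.
    by rewrite col_mxEd; have := M1 k; rewrite mxE.
  + case: (split_ordP i) => k -> /= => [|jk _]; first by rewrite ord1.
    have [|l E] := widenE j; first by have := ltn_ord k; lia.
    rewrite col_mxEd E MYE.
    have -> : l = k by apply: val_inj; have := congr1 val E; rewrite /=; lia.
    exact: Y1.
  + rewrite orbF; case: (split_ordP i) => k -> ij /= ij'.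
      rewrite col_mxEu mxE L0 //; move: ij; rewrite -val_eqE /= ord1 /=; lia.
    rewrite col_mxEd; case: (ltnP j k) => jk.
      have [|l E] := widenE j; first by have := ltn_ord k; lia.
      by rewrite E MYE Y0 //; have := congr1 val E; rewrite /=; lia.
    case: (split_ordP j) => l E; move: ij ij' jk; rewrite E -val_eqE /=.
      by rewrite ord1 /=; lia.
    move=> ij ij' jk; have := M0 k l; rewrite mxE => -> //; lia.
- by rewrite mul_block_col !mul1mx !mul0mx addr0 add0r LM vsubmxK.
Qed.

Lemma block1_lower_bidiag (R : realType) (n m : nat) (M : 'M[R]_n) :
  lower_bidiag m M -> lower_bidiag m.+1 (block_mx (1%:M : 'M_1) 0 0 M).
Proof.
move=> [M1 M2 M3]; split=> [i|i j|i j].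
- case: (split_ordP i) => k ->; rewrite ?block_mxEul ?block_mxEdr //.
  by rewrite mxE eqxx.
- case: (split_ordP i) => k ->; case: (split_ordP j) => l -> /=;
    rewrite ?[k]ord1 ?[l]ord1 //.
  by rewrite block_mxEdr => kl ml; apply: M2; lia.
- case: (split_ordP i) => k ->; case: (split_ordP j) => l -> /=.
  + by rewrite [k]ord1 [l]ord1 eqxx.
  + by rewrite block_mxEur mxE.
  + by rewrite block_mxEdl mxE.
  + rewrite (inj_eq (@rshift_inj _ _)) block_mxEdr => kl h; apply: M3 => //; lia.
Qed.

Lemma lower_factorization (R : realType) (n p : nat) (L : 'M[R]_n) :
  (p <= n)%N -> unit_lower L -> lower_initial_pos p L ->
  exists Lh : nat -> 'M[R]_n,
    (forall i, (1 <= i <= p)%N -> lower_bidiag (p - i) (Lh i)) /\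
    L = \big[mulmx/1%:M]_(i <- index_iota 1 p.+1) Lh i.
Proof.
elim: p n L => [|p IHp] n L pn Lu Lp.
  (* Without subdiagonals a unit lower triangular matrix is the identity, that is, the empty
     product. *)
  exists (fun=> 1%:M); split=> [i|]; first by lia.
  rewrite big_nil; case: Lu Lp => L1 L0 [Lb _]; apply/matrixP => i j.
  rewrite mxE; case: (ltngtP i j) => [ij|ij|/val_inj->]; last by rewrite L1 eqxx.
  + by rewrite L0 // -val_eqE /= ltn_eqF.
  + by rewrite Lb ?addn0 // -val_eqE /= gtn_eqF.
case: n L pn Lu Lp => // n L pn Lu Lp.
have [L2 [B [L2u L2p Bb LE]]] := peel_bidiagonal Lu Lp.
have [Lh [Lhb L2E]] := IHp n L2 pn L2u L2p.
(* [B] is the unpadded last factor; the factors of [L2] each gain one row and column of padding. *)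
exists (fun i => if i == p.+1 then B
                 else block_mx (1%:M : 'M_1) 0 0 (Lh i) : 'M_(1 + n)); split.
  move=> i ip; case: eqP => [->|/eqP ne]; first by rewrite subnn.
  rewrite subSn; last by lia.
  by apply/block1_lower_bidiag/Lhb; lia.
rewrite big_nat_recr //= eqxx LE L2E; congr (_ *m _).
transitivity (\big[mulmx/1%:M]_(i <- index_iota 1 p.+1)
    (block_mx (1%:M : 'M_1) 0 0 (Lh i) : 'M_(1 + n))).
  elim: (index_iota _ _) => [|i s IHs].
    by rewrite !big_nil -scalar_mx_block.
  by rewrite !big_cons -IHs mulmx_block !mul1mx !mul0mx !mulmx0 !addr0 add0r.
by apply: eq_big_nat => i ip; rewrite ltn_eqF //; lia.
Qed.

(** * Corner submatrices, initial minors and the equivalence *)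

Lemma nontrivial_window_first (n p q r s : nat) (h0 : (r <= n)%N)
    (h : (s + r <= n)%N) :
  (s <= p)%N -> nontrivial_sub p q (window h) (first_idx h0).
Proof. by move=> sp [k] /=; lia. Qed.

Lemma nontrivial_first_window (n p q r s : nat) (h0 : (r <= n)%N)
    (h : (s + r <= n)%N) :
  (s <= q)%N -> nontrivial_sub p q (first_idx h0) (window h).
Proof. by move=> sq [k] /=; lia. Qed.

Lemma trivial_sub_swap (p q r n : nat) (f g : 'I_r -> 'I_n) :
  trivial_sub p q f g <-> trivial_sub q p g f.
Proof. by split=> -[k fgk]; exists k; lia. Qed.

Lemma Delta_down_tr (R : realType) (n i : nat) (h : (i <= n)%N) (T : 'M[R]_n) :
  Delta_down h T^T = (Delta_up h T)^T.
Proof. by rewrite trmx_mxsub. Qed.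

(** Minors of a submatrix are minors of [T]: the trivial ones vanish by bandedness, the others are
    positive. *)
Lemma BTP_sub_TN (R : realType) (n p q m : nat) (T : 'M[R]_n)
    (a b : 'I_m -> 'I_n) :
  banded p q T -> banded_totally_positive p q T ->
  increasing a -> increasing b -> totally_nonnegative (mxsub a b T).
Proof.
move=> bT Tp ai bi r f g fi gi; rewrite -mxsub_comp.
have afi := increasing_comp ai fi; have bgi := increasing_comp bi gi.
have [tr|ntr] := pselect (trivial_sub p q (a \o f) (b \o g)).
  by rewrite (det_trivial_sub bT).
exact/ltW/Tp.
Qed.

Lemma BTP_corners (R : realType) (n p q : nat) (T : 'M[R]_n) :
  banded p q T -> banded_totally_positive p q T ->
  corners_nonsingular_TN p q T.
Proof.
move=> bT Tp i h i0.
have fi := @window_increasing n i 0 h.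
have li := window_increasing (last_subproof h).
by split=> ntr; split; rewrite ?unitmxE ?unitfE ?lt0r_neq0 //;
  (exact: Tp || exact: BTP_sub_TN bT Tp _ _).
Qed.

(** The minor is a leading minor of the corner of size [n - s], whose rows start at [s]. For [r > 0]
    its nontriviality forces [s <= p], which makes that corner nontrivial too. *)
Lemma corners_lower_initial (R : realType) (n p q : nat) (T : 'M[R]_n) :
  corners_nonsingular_TN p q T ->
  forall (r s : nat) (h0 : (r <= n)%N) (h : (s + r <= n)%N),
  nontrivial_sub p q (window h) (first_idx h0) ->
  0 < \det (mxsub (window h) (first_idx h0) T).
Proof.
move=> Tc [|r] s h0 h ntr; first by rewrite det_mx00.
have sp : (s <= p)%N.
  by rewrite leqNgt; apply/negP => ps; apply: ntr; exists ord0 => /=; lia.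
have hi : (n - s <= n)%N by lia.
have [|_ []] := Tc (n - s)%N hi; first by lia.
  by apply: nontrivial_window_first; lia.
move=> Du DTN; have hr : (r.+1 <= n - s)%N by lia.
have := TN_unit_leading_gt0 DTN Du hr; rewrite /Delta_down -mxsub_comp.
congr (0 < \det _); apply: eq_mxsub => k; apply: val_inj => //=; lia.
Qed.

Lemma corners_tr (R : realType) (n p q : nat) (T : 'M[R]_n) :
  corners_nonsingular_TN p q T -> corners_nonsingular_TN q p T^T.
Proof.
move=> Tc i h i0; have [Tu Td] := Tc i h i0.
have Delta_up_tr : Delta_up h T^T = (Delta_down h T)^T by rewrite trmx_mxsub.
rewrite Delta_down_tr Delta_up_tr !unitmx_tr; split=> ntr.
- have [|-> /TN_tr//] := Td; by move/trivial_sub_swap.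
- have [|-> /TN_tr//] := Tu; by move/trivial_sub_swap.
Qed.

Lemma corners_initial_minors (R : realType) (n p q : nat) (T : 'M[R]_n) :
  corners_nonsingular_TN p q T -> initial_minors_positive p q T.
Proof.
move=> Tc r s h0 h; split=> ntr; last exact: corners_lower_initial Tc _ _ _ _ ntr.
rewrite -det_tr trmx_mxsub; apply: corners_lower_initial (corners_tr Tc) _ _ _ _ _.
by move/trivial_sub_swap.
Qed.

Lemma initial_minors_factorization (R : realType) (n p q : nat) (T : 'M[R]_n) :
  (p <= n)%N -> (q <= n)%N -> banded p q T ->
  initial_minors_positive p q T -> bidiagonal_factorization p q T.
Proof.
move=> hp hq bT Ti.
have Tlow : lower_initial_pos p T.
  split=> [i j ij|r s h0 h sp]; first by rewrite bT // ij orbT.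
  by apply: (Ti r s h0 h).2; apply: nontrivial_window_first.
have Tup : lower_initial_pos q T^T.
  split=> [i j ij|r s h0 h sq]; first by rewrite mxE bT // ij.
  rewrite -det_tr trmx_mxsub trmxK.
  by apply: (Ti r s h0 h).1; apply: nontrivial_first_window.
have [L [Y [Lu Yp TE]]] : exists L Y : 'M[R]_n,
    [/\ unit_lower L, upper_pos Y & T = L *m Y].
  by apply: LU_factorization => r h; apply: (Tlow.2 r 0%N h h (leq0n _)).
have [Y1 Y0] := Yp; have [L1 L0] := Lu.
pose d : 'rV[R]_n := \row_k Y k k.
(* Dividing each row of [Y] by its diagonal entry gives [V^T], with unit diagonal. *)
pose V : 'M[R]_n := \matrix_(i, j) (Y j i / Y j j).
have YE : Y = diag_mx d *m V^T.
  apply/matrixP => i j.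
  by rewrite mul_diag_mx !mxE mulrC divfK // gt_eqF.
have Vu : unit_lower V.
  split=> [i|i j ij]; rewrite mxE ?divff ?gt_eqF //.
  by rewrite Y0 // mul0r.
(* [T^T] is [V] times the positive upper triangular matrix [diag_mx d *m L^T], so [V] inherits from
   [T^T] what [L] inherits from [T]. *)
have Vp : lower_initial_pos q V.
  apply: (@lower_initial_pos_upper _ _ _ T^T V (diag_mx d *m L^T)) Tup.
    by rewrite TE YE !trmx_mul trmxK tr_diag_mx mulmxA.
  split=> [i|i j ij]; rewrite mul_diag_mx !mxE ?L1 ?mulr1 //.
  by rewrite L0 // mulr0.
have [Lh [Lhb LE]] := lower_factorization hp Lu (lower_initial_pos_upper TE Yp Tlow).
have [Vh [Vhb VE]] := lower_factorization hq Vu Vp.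
exists Lh, (fun i => (Vh i)^T), d; split.
- move=> i ip; have e : (p - i + (n - p + i))%N = n by lia.
  exact/(padded_lowerP _ e)/Lhb.
- move=> i iq; have e : (q - i + (n - q + i))%N = n by lia.
  by apply/(padded_upperP _ e); rewrite trmxK; apply: Vhb.
- by move=> k; rewrite mxE.
- rewrite -LE -mulmxA TE YE; congr (_ *m (_ *m _)); rewrite VE.
  rewrite -[RHS]trmxK trmx_prod_rev; congr (_^T).
  by apply: eq_bigr => i _; rewrite trmxK.
Qed.

Theorem theorem2p16 (R : realType) (n p q : nat) (T : 'M[R]_n)
    (hp : (p <= n)%N) (hq : (q <= n)%N) (hT : banded p q T) :
  [<-> banded_totally_positive p q T;
       corners_nonsingular_TN p q T;
       initial_minors_positive p q T;
       bidiagonal_factorization p q T].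
Proof.
tfae.
- exact: BTP_corners.
- exact: corners_initial_minors.
- exact: initial_minors_factorization.
- exact: factorization_BTP.
Qed.
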